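(* Let $\mathcal{D}$ be a triangulated category in which every object is a finite direct sum of indecomposable objects, and assume that $\mathcal{D}$ is a block. Let $X,Y$ be indecomposable objects in $\mathcal{D}$. Then there exists a path from $X$ to $Y[n]$ for some $n\geq 0$.
   Context: The translation functor is denoted $[1]$. $\mathcal{D}$ is not assumed to have split idempotents. A triangulated category is a block if it is nonzero and does not admit a proper decomposition $\mathcal{D}=\mathcal{D}_1\times\mathcal{D}_2$ as a product of two (nonzero) triangulated subcategories. A path of length $n$ from $X_0$ to $X_n$ is a sequence $X_0,X_1,\dots,X_n$ of indecomposable objects in $\mathcal{D}$ such that for each $1\leq i\leq n$ we have $\mathrm{Hom}_{\mathcal{D}}(X_{i-1},X_i)\neq 0$ or $X_i=X_{i-1}[1]$. *)

(* Defs.v *)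
From HB Require Import structures.
From mathcomp Require Import all_boot all_order all_algebra.

Set Implicit Arguments.
Unset Strict Implicit.
Unset Printing Implicit Defensive.

Import GRing.Theory.
Local Open Scope ring_scope.

Declare Scope cat_scope.
Delimit Scope cat_scope with cat.

(* Classically every abelian group carries a [zmodType] structure, so typing
   the Hom groups in [zmodType] is no restriction. *)
Structure preadditive : Type := Preadditive {
  obj :> Type;
  hom : obj -> obj -> zmodType;
  idm : forall X, hom X X;
  comp : forall X Y Z, hom Y Z -> hom X Y -> hom X Z;
  compA : forall W X Y Z (h : hom Y Z) (g : hom X Y) (f : hom W X),
    comp h (comp g f) = comp (comp h g) f;
  comp1m : forall X Y (f : hom X Y), comp (idm Y) f = f;
  compm1 : forall X Y (f : hom X Y), comp f (idm X) = f;
  compDl : forall X Y Z (g g' : hom Y Z) (f : hom X Y),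
    comp (g + g') f = comp g f + comp g' f;
  compDr : forall X Y Z (g : hom Y Z) (f f' : hom X Y),
    comp g (f + f') = comp g f + comp g f'
}.

Arguments hom {p} X Y.
Arguments idm {p} X.
Arguments comp {p X Y Z} g f.

Notation "g ∘ f" := (comp g f) (at level 40, left associativity) : cat_scope.
Local Open Scope cat_scope.

Section Preadditive.
Variable C : preadditive.
Implicit Types X Y Z A B S : C.

Definition is_iso X Y (f : hom X Y) : Prop :=
  exists g : hom Y X, g ∘ f = idm X /\ f ∘ g = idm Y.

Definition isomorphic X Y : Prop := exists f : hom X Y, is_iso f.

Definition zero_object X : Prop :=
  forall Y, (forall f : hom X Y, f = 0) /\ (forall f : hom Y X, f = 0).

Definition is_biproduct A B S (i1 : hom A S) (i2 : hom B S)
    (p1 : hom S A) (p2 : hom S B) : Prop :=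
  [/\ p1 ∘ i1 = idm A, p2 ∘ i2 = idm B, p1 ∘ i2 = 0, p2 ∘ i1 = 0
    & i1 ∘ p1 + i2 ∘ p2 = idm S].

(* [S] is a direct sum of [A] and [B], for some choice of structure maps *)
Definition direct_sum A B S : Prop :=
  exists i1 i2 p1 p2, @is_biproduct A B S i1 i2 p1 p2.

(* The case [n = 0] says that [S] is a zero object. *)
Definition finite_direct_sum n (A : 'I_n -> C) S : Prop :=
  exists (i : forall k, hom (A k) S) (p : forall k, hom S (A k)),
    [/\ forall k, p k ∘ i k = idm (A k),
        forall k l, k != l -> p k ∘ i l = 0
      & \sum_k (i k ∘ p k) = idm S].

Definition indecomposable X : Prop :=
  ~ zero_object X /\
  forall A B, direct_sum A B X -> zero_object A \/ zero_object B.

Definition sums_of_indecomposables : Prop :=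
  forall X, exists n (A : 'I_n -> C),
    (forall k, indecomposable (A k)) /\ finite_direct_sum A X.

Definition is_additive : Prop :=
  (exists Z, zero_object Z) /\ (forall A B, exists S, direct_sum A B S).

End Preadditive.

Structure add_endofunctor (C : preadditive) : Type := AddEndofunctor {
  fobj :> C -> C;
  fmap : forall X Y : C, hom X Y -> hom (fobj X) (fobj Y);
  fmap1 : forall X : C, fmap (idm X) = idm (fobj X);
  fmapM : forall (X Y Z : C) (g : hom Y Z) (f : hom X Y),
    fmap (g ∘ f) = fmap g ∘ fmap f;
  fmapD : forall (X Y : C) (f f' : hom X Y), fmap (f + f') = fmap f + fmap f'
}.

Arguments fmap {C} F {X Y} f : rename.

Definition autoequivalence (C : preadditive) (F : add_endofunctor C) : Prop :=
  (forall X Y : C, bijective (fun f : hom X Y => fmap F f)) /\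
  (forall Y : C, exists X : C, isomorphic (F X) Y).

(* The translation functor [shift] is only required to be an auto-equivalence;
   [dist f g h] says that X -f-> Y -g-> Z -h-> X[1] is distinguished. *)
Structure triangulated : Type := Triangulated {
  tcat :> preadditive;
  tcat_additive : is_additive tcat;
  shift : add_endofunctor tcat;
  shift_equiv : autoequivalence shift;
  dist : forall X Y Z : tcat,
    hom X Y -> hom Y Z -> hom Z (shift X) -> Prop;
  dist_id : forall X Z : tcat, zero_object Z ->
    dist (idm X) (0 : hom X Z) (0 : hom Z (shift X));
  dist_cone : forall (X Y : tcat) (f : hom X Y),
    exists (Z : tcat) (g : hom Y Z) (h : hom Z (shift X)), dist f g h;
  dist_iso : forall (X Y Z X' Y' Z' : tcat)
      (f : hom X Y) (g : hom Y Z) (h : hom Z (shift X))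
      (f' : hom X' Y') (g' : hom Y' Z') (h' : hom Z' (shift X'))
      (a : hom X X') (b : hom Y Y') (c : hom Z Z'),
    is_iso a -> is_iso b -> is_iso c ->
    b ∘ f = f' ∘ a -> c ∘ g = g' ∘ b -> fmap shift a ∘ h = h' ∘ c ->
    dist f g h -> dist f' g' h';
  dist_rot : forall (X Y Z : tcat)
      (f : hom X Y) (g : hom Y Z) (h : hom Z (shift X)),
    dist f g h <-> dist g h (- fmap shift f);
  dist_mor : forall (X Y Z X' Y' Z' : tcat)
      (f : hom X Y) (g : hom Y Z) (h : hom Z (shift X))
      (f' : hom X' Y') (g' : hom Y' Z') (h' : hom Z' (shift X'))
      (a : hom X X') (b : hom Y Y'),
    dist f g h -> dist f' g' h' -> b ∘ f = f' ∘ a ->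
    exists c : hom Z Z', c ∘ g = g' ∘ b /\ fmap shift a ∘ h = h' ∘ c;
  dist_octahedral : forall (X Y Z X' Y' Z' : tcat)
      (f : hom X Y) (u : hom Y Z') (u' : hom Z' (shift X))
      (g : hom Y Z) (v : hom Z X') (v' : hom X' (shift Y))
      (w : hom Z Y') (w' : hom Y' (shift X)),
    dist f u u' -> dist g v v' -> dist (g ∘ f) w w' ->
    exists (a : hom Z' Y') (b : hom Y' X'),
      [/\ dist a b (fmap shift u ∘ v'),
          a ∘ u = w ∘ g, w' ∘ a = u',
          b ∘ w = v & v' ∘ b = fmap shift f ∘ w']
}.

Arguments shift {D} : rename.
Arguments dist {D X Y Z} f g h : rename.

Section Triangulated.
Variable D : triangulated.

Definition shiftn (n : nat) (X : D) : D := iter n shift X.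

(* A full, replete subcategory is given by its class of objects. Given
   repleteness, the implication [P (shift X) -> P X] is closure under [-1]. *)
Definition triangulated_subcategory (P : D -> Prop) : Prop :=
  [/\ forall X Y : D, isomorphic X Y -> P X -> P Y,
      forall X : D, zero_object X -> P X,
      forall X : D, P X <-> P (shift X)
    & forall (X Y Z : D) (f : hom X Y) (g : hom Y Z) (h : hom Z (shift X)),
        dist f g h -> P X -> P Y -> P Z].

(* D = D1 x D2: the functor (A, B) |-> A (+) B from the product category
   D1 x D2 to D is essentially surjective and fully faithful. It is then
   automatically an equivalence of triangulated categories, as direct sums of
   distinguished triangles are distinguished. *)
Definition product_decomposition (P1 P2 : D -> Prop) : Prop :=
  [/\ triangulated_subcategory P1, triangulated_subcategory P2,
      forall X : D, exists A B : D, [/\ P1 A, P2 B & direct_sum A B X]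
    & forall (A B S A' B' S' : D)
        (i1 : hom A S) (i2 : hom B S) (p1 : hom S A) (p2 : hom S B)
        (i1' : hom A' S') (i2' : hom B' S') (p1' : hom S' A') (p2' : hom S' B'),
        P1 A -> P2 B -> P1 A' -> P2 B' ->
        is_biproduct i1 i2 p1 p2 -> is_biproduct i1' i2' p1' p2' ->
        bijective (fun fg : hom A A' * hom B B' =>
                     i1' ∘ fg.1 ∘ p1 + i2' ∘ fg.2 ∘ p2)].

Definition nonzero_class (P : D -> Prop) : Prop :=
  exists X : D, P X /\ ~ zero_object X.

Definition is_block : Prop :=
  (exists X : D, ~ zero_object X) /\
  ~ (exists P1 P2 : D -> Prop,
       [/\ product_decomposition P1 P2, nonzero_class P1 & nonzero_class P2]).

(* Only the values [Z 0, ..., Z n] matter. *)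
Definition is_path (n : nat) (X Y : D) : Prop :=
  exists Z : nat -> D,
    [/\ Z 0%N = X, Z n = Y,
        forall i, (i <= n)%N -> indecomposable (Z i)
      & forall i, (i < n)%N ->
          (exists f : hom (Z i) (Z i.+1), f <> 0) \/ Z i.+1 = shift (Z i)].

End Triangulated.

(* Main.v *)
From Stdlib Require Import Classical.
From mathcomp Require Import all_boot all_order all_algebra.
Require Import Defs.

(** A property [Q] of objects that is invariant under the translation and under
    nonzero morphisms between indecomposables splits the indecomposables into
    two Hom-orthogonal, translation-stable classes; these generate a product
    decomposition, so in a block [Q] holds for all indecomposables or for none.
    Apply this to "some [A[n]] is the end of a path from [X]". Only invariance
    along a nonzero [f : B -> A] against its direction is not obvious. Let
    [A -g-> C -h-> B[1]] complete [f] to a triangle and decompose [C] into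
    indecomposables [C_k]. If for some [k] both components [A -> C_k] and
    [C_k -> B[1]] are nonzero, they form a path from [A] to [B[1]]. Otherwise
    [g] vanishes, because a nonzero component [A -> C_k] would be a split
    epimorphism, hence monic, and it kills [f]; so [f] has a section
    [A -> B], which is nonzero. *)

Set Implicit Arguments.
Unset Strict Implicit.
Unset Printing Implicit Defensive.

Import GRing.Theory.
Local Open Scope ring_scope.
Local Open Scope cat_scope.

(** * Preadditive categories: zero objects, biproducts, splitting off partial sums *)

Section Preadditive.
Variable C : preadditive.
Implicit Types X Y Z A B S : C.

Lemma comp0m X Y Z (f : hom X Y) : (0 : hom Y Z) ∘ f = 0.
Proof. by apply: (addrI (0 ∘ f)); rewrite -compDl !addr0. Qed.

Lemma compm0 X Y Z (g : hom Y Z) : g ∘ (0 : hom X Y) = 0.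
Proof. by apply: (addrI (g ∘ 0)); rewrite -compDr !addr0. Qed.

Lemma compNm X Y Z (g : hom Y Z) (f : hom X Y) : (- g) ∘ f = - (g ∘ f).
Proof. by apply: (addrI (g ∘ f)); rewrite -compDl !subrr comp0m. Qed.

Lemma compmN X Y Z (g : hom Y Z) (f : hom X Y) : g ∘ (- f) = - (g ∘ f).
Proof. by apply: (addrI (g ∘ f)); rewrite -compDr !subrr compm0. Qed.

Lemma comp_suml I (r : seq I) (P : pred I) X Y Z (g : I -> hom Y Z)
    (f : hom X Y) :
  (\sum_(k <- r | P k) g k) ∘ f = \sum_(k <- r | P k) (g k ∘ f).
Proof.
exact: (big_morph (fun h => h ∘ f) (fun h h' => compDl h h' f) (comp0m Z f)).
Qed.

Lemma comp_sumr I (r : seq I) (P : pred I) X Y Z (g : hom Y Z)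
    (f : I -> hom X Y) :
  g ∘ (\sum_(k <- r | P k) f k) = \sum_(k <- r | P k) (g ∘ f k).
Proof. exact: (big_morph (fun f => g ∘ f) (compDr g) (compm0 X g)). Qed.

Lemma zero_objectP X : zero_object X <-> idm X = 0.
Proof.
split=> [/(_ X)[X0 _]|X0 Y]; first exact: X0.
split=> f.
  by rewrite -[f]compm1 X0 compm0.
by rewrite -[f]comp1m X0 comp0m.
Qed.

Lemma zero_object_retract X Y (f : hom X Y) (g : hom Y X) :
  g ∘ f = idm X -> zero_object Y -> zero_object X.
Proof. by move=> gf /(_ X)[_ Y0]; apply/zero_objectP; rewrite -gf (Y0 f) compm0. Qed.

Lemma section_neq0 X Y (f : hom X Y) (g : hom Y X) :
  ~ zero_object X -> g ∘ f = idm X -> f <> 0.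
Proof. by move=> nX gf f0; apply/nX/zero_objectP; rewrite -gf f0 compm0. Qed.

Lemma is_biproduct_iso A B S A' B' S' (a : hom A A') (a' : hom A' A)
    (b : hom B B') (b' : hom B' B) (s : hom S S') (s' : hom S' S)
    (i1 : hom A S) (i2 : hom B S) (p1 : hom S A) (p2 : hom S B) :
    a' ∘ a = idm A -> a ∘ a' = idm A' -> b' ∘ b = idm B -> b ∘ b' = idm B' ->
    s' ∘ s = idm S -> s ∘ s' = idm S' -> is_biproduct i1 i2 p1 p2 ->
  is_biproduct (s ∘ i1 ∘ a') (s ∘ i2 ∘ b') (a ∘ p1 ∘ s') (b ∘ p2 ∘ s').
Proof.
move=> a'a aa' b'b bb' s's ss' [p1i1 p2i2 p1i2 p2i1 ip].
have K (E F : C) (e : hom S E) (f : hom F S) : (e ∘ s') ∘ (s ∘ f) = e ∘ f.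
  by rewrite compA -(compA e) s's compm1.
split; rewrite ?[_ ∘ (_ ∘ a')]compA ?[_ ∘ (_ ∘ b')]compA ?K.
- by rewrite -(compA a) p1i1 compm1.
- by rewrite -(compA b) p2i2 compm1.
- by rewrite -(compA a) p1i2 compm0 comp0m.
- by rewrite -(compA b) p2i1 compm0 comp0m.
- have L (E F : C) (e : hom E S) (f : hom S E) (t : hom E F) (t' : hom F E) :
    t' ∘ t = idm E -> (s ∘ e ∘ t') ∘ (t ∘ f ∘ s') = s ∘ (e ∘ f) ∘ s'.
    by move=> t't; rewrite !compA -(compA (s ∘ e)) t't compm1.
  by rewrite !L // -compDl -compDr ip compm1.
Qed.

Lemma indecomposable_iso X Y :
  isomorphic X Y -> indecomposable X -> indecomposable Y.
Proof.
move=> [f [g [gf fg]]] [nX dX]; split; first by move=> /(zero_object_retract gf)/nX.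
move=> A B [i1 [i2 [p1 [p2 bip]]]]; apply: dX.
have /= := is_biproduct_iso (comp1m (idm A)) (comp1m (idm A)) (comp1m (idm B))
  (comp1m (idm B)) fg gf bip.
by move=> ?; do 4!eexists; eassumption.
Qed.

Lemma isomorphic_sym X Y : isomorphic X Y -> isomorphic Y X.
Proof. by move=> [f [g [gf fg]]]; exists g, f. Qed.

(* Splits the idempotent [\sum_(k <- s) i k ∘ p k]. *)
Lemma partial_sum n (A : 'I_n -> C) S (i : forall k, hom (A k) S)
    (p : forall k, hom S (A k)) (s : seq 'I_n) :
    is_additive C -> (forall k, p k ∘ i k = idm (A k)) ->
    (forall k l, k != l -> p k ∘ i l = 0) -> uniq s ->
  exists (T : C) (j : hom T S) (q : hom S T),
    q ∘ j = idm T /\ j ∘ q = \sum_(k <- s) (i k ∘ p k).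
Proof.
move=> [[Z Z0] sums] pi1 pi0; elim: s => [_|k s IHs /= /andP[ks us]].
  exists Z, 0, 0; rewrite big_nil comp0m compm0; split=> //.
  by have /zero_objectP-> := Z0.
have [T [j [q [qj jq]]]] := IHs us.
(* Since [j = (j ∘ q) ∘ j] and [q = q ∘ (j ∘ q)], orthogonality to the partial sum [j ∘ q] passes to
   [j] and [q]. *)
have kj0 : p k ∘ j = 0.
  rewrite -[j]compm1 -qj [j ∘ _]compA jq comp_suml comp_sumr.
  rewrite big_seq big1 // => l ls; rewrite -compA compA pi0 ?comp0m //.
  by apply: contraNneq ks => ->.
have qk0 : q ∘ i k = 0.
  rewrite -[q]comp1m -qj -[q ∘ j ∘ q]compA jq comp_sumr comp_suml.
  rewrite big_seq big1 // => l ls; rewrite compA -compA pi0 ?compm0 //.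
  by apply: contraNneq ks => <-.
have [R [i1 [i2 [p1 [p2 [p1i1 p2i2 p1i2 p2i1 ip]]]]]] := sums (A k) T.
exists R, (i k ∘ p1 + j ∘ p2), (i1 ∘ p k + i2 ∘ q).
have K (E F G H I : C) (a : hom H I) (b : hom G H) (c : hom F G) (d : hom E F) :
  a ∘ b ∘ (c ∘ d) = a ∘ (b ∘ c) ∘ d by rewrite !compA.
split; rewrite !compDl !compDr !K.
  by rewrite pi1 kj0 qk0 qj !compm0 !comp0m !compm1 addr0 add0r.
by rewrite p1i1 p1i2 p2i1 p2i2 !compm0 !comp0m !compm1 addr0 add0r big_cons jq.
Qed.

End Preadditive.

(** * Additive auto-equivalences and indecomposability *)

Section Functor.
Variables (C : preadditive) (F : add_endofunctor C).

Lemma fmap0 (X Y : C) : fmap F (0 : hom X Y) = 0.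
Proof. by apply: (addrI (fmap F 0)); rewrite -fmapD !addr0. Qed.

Lemma zero_object_fmap (X : C) : zero_object X -> zero_object (F X).
Proof. by move=> /zero_objectP X0; apply/zero_objectP; rewrite -fmap1 X0 fmap0. Qed.

Lemma is_biproduct_fmap (A B S : C) (i1 : hom A S) (i2 : hom B S)
    (p1 : hom S A) (p2 : hom S B) :
  is_biproduct i1 i2 p1 p2 ->
  is_biproduct (fmap F i1) (fmap F i2) (fmap F p1) (fmap F p2).
Proof.
move=> [e1 e2 e3 e4 e5].
by split; rewrite -?fmapM -?fmapD ?e1 ?e2 ?e3 ?e4 ?e5 ?fmap1 ?fmap0.
Qed.

Hypothesis eqF : autoequivalence F.

Lemma fmap_inj (X Y : C) : injective (fun f : hom X Y => fmap F f).
Proof. exact: bij_inj (eqF.1 X Y). Qed.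

Lemma fmap_surj (X Y : C) (g : hom (F X) (F Y)) : exists f : hom X Y, fmap F f = g.
Proof. by have [h _ hK] := eqF.1 X Y; exists (h g); apply: hK. Qed.

Lemma fmap_neq0 (X Y : C) (f : hom X Y) : f <> 0 -> fmap F f <> 0.
Proof. by move=> f0 Ff0; apply/f0/fmap_inj; rewrite Ff0 fmap0. Qed.

Lemma zero_object_fmapE (X : C) : zero_object (F X) -> zero_object X.
Proof.
move=> /zero_objectP FX0; apply/zero_objectP/fmap_inj.
by rewrite fmap1 fmap0.
Qed.

Lemma indecomposable_fmap (X : C) : indecomposable X <-> indecomposable (F X).
Proof.
split=> -[nX dX]; split; try by move=> /zero_object_fmap/nX.
- by move=> /zero_object_fmapE/nX.
- move=> A B [i1 [i2 [p1 [p2 bip]]]].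
  (* Essential surjectivity replaces the summands by [F A'] and [F B']; fullness then lifts the
     structure maps and faithfulness their equations. *)
  have [A' [a' [a [aa' a'a]]]] := eqF.2 A.
  have [B' [b' [b [bb' b'b]]]] := eqF.2 B.
  have := is_biproduct_iso a'a aa' b'b bb' (comp1m (idm (F X)))
    (comp1m (idm (F X))) bip.
  set j1 := (X in is_biproduct X); set j2 := (X in is_biproduct _ X).
  set q1 := (X in is_biproduct _ _ X); set q2 := (X in is_biproduct _ _ _ X).
  have [j1' <-] := fmap_surj j1; have [j2' <-] := fmap_surj j2.
  have [q1' <-] := fmap_surj q1; have [q2' <-] := fmap_surj q2.
  move=> [e1 e2 e3 e4 e5].
  have [|A0|B0] := dX A' B'.
  + by exists j1', j2', q1', q2'; split; apply: fmap_inj;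
      rewrite ?fmapD ?fmapM ?fmap1 ?fmap0.
  + by left; apply: zero_object_retract a'a (zero_object_fmap A0).
  + by right; apply: zero_object_retract b'b (zero_object_fmap B0).
- move=> A B [i1 [i2 [p1 [p2 /is_biproduct_fmap bip]]]].
  have [|/zero_object_fmapE|/zero_object_fmapE] := dX (F A) (F B);
    [|by left|by right].
  by do 4!eexists; eassumption.
Qed.

End Functor.

(** * Exactness of triangles and reversing a nonzero morphism *)

Section Triangulated.
Variable D : triangulated.
Implicit Types X Y Z A B W : D.

Let equiv := shift_equiv D.

Lemma dist_comp0 X Y Z (f : hom X Y) (g : hom Y Z) (h : hom Z (shift X)) :
  dist f g h -> g ∘ f = 0.
Proof.
have [[O O0] _] := tcat_additive D.
move=> dist_f.
have [|c [<- _]] := dist_mor (dist_id X O0) dist_f (a := idm X) (b := f).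
  by [].
by rewrite compm0.
Qed.

(** The pair [u], [0] extends to a morphism from the rotated triangle of [idm W] to the rotation of
    the given one; its third component [W[1] -> X[1]] is the translate of [v]. *)
Lemma dist_factor X Y Z W (f : hom X Y) (g : hom Y Z) (h : hom Z (shift X))
    (u : hom W Y) :
  dist f g h -> g ∘ u = 0 -> exists v : hom W X, u = f ∘ v.
Proof.
have [[O O0] _] := tcat_additive D.
have /dist_rot distW := dist_id W O0.
move=> /dist_rot distf gu0.
have [|c [_]] := dist_mor distW distf (a := u) (b := 0); first by rewrite gu0 comp0m.
rewrite fmap1 compmN compm1 compNm => /oppr_inj uc.
have [v vc] := fmap_surj equiv c; exists v.
by apply: (fmap_inj equiv); rewrite fmapM vc.
Qed.

(** Idempotents may fail to split, so the complement of [B] in [A] is obtained as the cone [K] of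
    [s]. The triangle splits, giving [A] as the direct sum of [B] and [K], whence [K] is zero. *)
Lemma split_epi_monic A B (r : hom A B) (s : hom B A) :
    indecomposable A -> ~ zero_object B -> r ∘ s = idm B ->
  forall W (x : hom W A), r ∘ x = 0 -> x = 0.
Proof.
move=> [_ dA] nB rs; have [K [q [z dist_s]]] := dist_cone s.
have qs := dist_comp0 dist_s.
have z0 : z = 0.
  have /dist_rot/dist_rot/dist_comp0/eqP := dist_s; rewrite compNm oppr_eq0.
  move=> /eqP sz; rewrite -[z]comp1m -fmap1 -rs fmapM -compA.
  by rewrite sz compm0.
have [|t qt] := dist_factor (u := idm K) ((dist_rot _ _ _).1 dist_s).
  by rewrite z0 comp0m.
(* Corrects the section [t] of [q] so that [r] kills it. *)
pose t' := t - s ∘ r ∘ t.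
have rt' : r ∘ t' = 0 by rewrite /t' compDr compmN !compA rs comp1m subrr.
have qt' : q ∘ t' = idm K by rewrite /t' compDr compmN !compA qs !comp0m subr0.
have ip : s ∘ r + t' ∘ q = idm A.
  (* The error [e] is killed by [q], so [e = s ∘ v]; then [v = r ∘ e = 0]. *)
  apply/eqP; rewrite eq_sym -subr_eq0; apply/eqP; set e := _ - _.
  have qe : q ∘ e = 0.
    rewrite /e compDr compmN compDr !compA qs qt'.
    by rewrite comp0m comp1m compm1 add0r subrr.
  have re : r ∘ e = 0.
    rewrite /e compDr compmN compDr !compA rs rt'.
    by rewrite comp0m comp1m compm1 addr0 subrr.
  have [v ev] := dist_factor dist_s qe.
  by move: re; rewrite ev compA rs comp1m => ->; rewrite compm0.
have [|//|K0 W x rx] := dA B K; first by exists s, t', r, q; split.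
rewrite -[x]comp1m -ip compDl -!compA rx compm0 add0r.
by rewrite ((K0 W).2 (q ∘ x)) compm0.
Qed.

Lemma hom_backward A B (f : hom B A) :
    sums_of_indecomposables D -> indecomposable A -> f <> 0 ->
  (exists t : hom A B, t <> 0) \/
  (exists W (u : hom A W) (v : hom W (shift B)),
     [/\ indecomposable W, u <> 0 & v <> 0]).
Proof.
move=> hsum iA f0; have [W [g [h dist_f]]] := dist_cone f.
have [n [T [iT [i [p [pi1 pi0 ip]]]]]] := hsum W.
have [/existsP[k /andP[/eqP gk /eqP hk]]|nk] :=
    boolP [exists k, (p k ∘ g != 0) && (h ∘ i k != 0)].
  by right; exists (T k), (p k ∘ g), (h ∘ i k); split.
left; have g0 : g = 0.
  rewrite -[g]comp1m -ip comp_suml big1 // => k _; rewrite -compA.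
  have [->|gk] := eqVneq (p k ∘ g) 0; first by rewrite compm0.
  have [hk|hk] := eqVneq (h ∘ i k) 0; last first.
    by case/existsP: nk; exists k; rewrite gk.
  (* As [h ∘ i k = 0], the inclusion [i k] factors through [g], and the factor [s] is a section of
     [p k ∘ g]. *)
  have [s sE] := dist_factor ((dist_rot _ _ _).1 dist_f) hk.
  have ps : p k ∘ g ∘ s = idm (T k) by rewrite -compA -sE pi1.
  case: f0; apply: (split_epi_monic iA (iT k).1 ps).
  by rewrite -compA (dist_comp0 dist_f) compm0.
have [|t ft] := dist_factor (u := idm A) dist_f; first by rewrite g0 comp0m.
by exists t; apply: section_neq0 iA.1 (esym ft).
Qed.

(** * Orthogonal classes as triangulated subcategories *)

(** For an invariant [Q], and with finite decompositions into indecomposables, these are the sums of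
    indecomposables outside [Q]; phrased by orthogonality, the class is visibly closed under
    cones. *)
Definition right_orthogonal (Q : D -> Prop) W : Prop :=
  forall B (f : hom B W), indecomposable B -> Q B -> f = 0.

Section InvariantClass.
Variable Q : D -> Prop.
Hypothesis Qshift : forall A, Q A <-> Q (shift A).
Hypothesis Qhom : forall A B (f : hom A B),
  indecomposable A -> indecomposable B -> f <> 0 -> Q A <-> Q B.

(** Up to an isomorphism [B'[1] -> B], a map [B -> W[1]] is the translate of a map [B' -> W]. That
    isomorphism is a nonzero morphism of indecomposables, so [Q] passes from [B] to [B'[1]], hence
    to [B']. *)
Lemma right_orthogonal_shift W :
  right_orthogonal Q W -> right_orthogonal Q (shift W).
Proof.
move=> oW B u iB QB.
have [B' isoB] := equiv.2 B; have [b [b' [b'b bb']]] := isoB.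
have iFB' := indecomposable_iso (isomorphic_sym isoB) iB.
have iB' := (indecomposable_fmap equiv B').2 iFB'.
have QB' : Q B' :=
  (Qshift B').2 ((Qhom iFB' iB (section_neq0 iFB'.1 b'b)).2 QB).
have [v vE] := fmap_surj equiv (u ∘ b).
by rewrite -[u]compm1 -bb' compA -vE (oW _ v) // fmap0 comp0m.
Qed.

Lemma right_orthogonal_triangulated :
  triangulated_subcategory (right_orthogonal Q).
Proof.
split=> [X Y [f [g [gf fg]]] oX B u iB QB|X X0 B u _ _|X
       |X Y Z f g h dist_f oX oY B u iB QB].
- by rewrite -[u]comp1m -fg -compA (oX _ (g ∘ u)) ?compm0.
- exact: (X0 B).2.
- split=> [|oX B u iB QB]; first exact: right_orthogonal_shift.
  apply: (fmap_inj equiv); rewrite fmap0; apply: oX; last exact: (Qshift B).1.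
  exact: (indecomposable_fmap equiv B).1.
(* The composite of [u] with [h] lands in [X[1]] and vanishes, so [u] factors through [Y]. *)
- have oFX := right_orthogonal_shift oX.
  have [|v ->] := dist_factor ((dist_rot _ _ _).1 dist_f) (u := u).
    exact: oFX.
  by rewrite (oY _ v) // compm0.
Qed.

End InvariantClass.

(* An indecomposable summand of [W] satisfying [Q] would have zero identity. *)
Lemma right_orthogonal_hom0 (Q : D -> Prop) W V (f : hom W V) :
    sums_of_indecomposables D -> right_orthogonal Q W ->
  right_orthogonal (fun A => ~ Q A) V -> f = 0.
Proof.
move=> hsum oW oV; have [n [T [iT [i [p [pi1 pi0 ip]]]]]] := hsum W.
rewrite -[f]compm1 -ip comp_sumr big1 // => k _; rewrite compA.
suff nQT : ~ Q (T k) by rewrite (oV _ (f ∘ i k)) ?comp0m.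
move=> QT; apply: (section_neq0 (iT k).1 (pi1 k)); exact: oW.
Qed.

Lemma right_orthogonal_sum (Q : D -> Prop) n (T : 'I_n -> D) W
    (i : forall k, hom (T k) W) (p : forall k, hom W (T k)) (s : seq 'I_n)
    V (j : hom V W) (q : hom W V) :
    q ∘ j = idm V -> j ∘ q = \sum_(k <- s) (i k ∘ p k) ->
    {in s, forall k, right_orthogonal Q (T k)} ->
  right_orthogonal Q V.
Proof.
move=> qj jq oT B u iB QB.
(* Expanding the middle idempotent makes every term factor through some [T k] with [k] in [s]. *)
have -> : u = q ∘ (j ∘ q) ∘ (j ∘ u) by rewrite !compA qj comp1m qj comp1m.
rewrite jq comp_sumr comp_suml.
rewrite big_seq big1 // => k /oT/(_ _ (p k ∘ (j ∘ u)) iB QB) ku.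
by rewrite -!compA ku !compm0.
Qed.

(** * The product decomposition defined by an invariant class *)

Section Block.
Hypothesis hsum : sums_of_indecomposables D.
Variable Q : D -> Prop.
Hypothesis Qshift : forall A, Q A <-> Q (shift A).
Hypothesis Qhom : forall A B (f : hom A B),
  indecomposable A -> indecomposable B -> f <> 0 -> Q A <-> Q B.

Lemma right_orthogonal_indecomposable A :
  indecomposable A -> ~ Q A -> right_orthogonal Q A.
Proof.
move=> iA nQA B u iB QB; apply/eqP; case: eqP => // u0.
by case: nQA; apply/(Qhom iB iA u0).
Qed.

Lemma right_orthogonalC_indecomposable A :
  indecomposable A -> Q A -> right_orthogonal (fun B => ~ Q B) A.
Proof.
move=> iA QA B u iB nQB; apply/eqP; case: eqP => // u0.
by case: nQB; apply/(Qhom iB iA u0).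
Qed.

Lemma right_orthogonal_decomposition :
  product_decomposition (right_orthogonal (fun A => ~ Q A)) (right_orthogonal Q).
Proof.
split.
- apply: right_orthogonal_triangulated => [A|A B f iA iB f0].
    by have [] := Qshift A; tauto.
  by have [] := Qhom iA iB f0; tauto.
- exact: right_orthogonal_triangulated.
- move=> X; have [n [T [iT [i [p [pi1 pi0 ip]]]]]] := hsum X.
  (* A boolean form of [Q] on the summands, by excluded middle, allows filtering the index
     sequence. *)
  have [b bQ] : exists b : 'I_n -> bool, forall k, b k <-> Q (T k).
    apply: (fin_all_exists (P := fun k (c : bool) => c <-> Q (T k))) => k.
    by have [QT|nQT] := classic (Q (T k)); [exists true|exists false].
  have add := tcat_additive D.
  have [A [i1 [p1 [p1i1 i1p1]]]] :=
    partial_sum add pi1 pi0 (filter_uniq b (index_enum_uniq _)).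
  have [B [i2 [p2 [p2i2 i2p2]]]] :=
    partial_sum add pi1 pi0 (filter_uniq (predC b) (index_enum_uniq _)).
  have oA : right_orthogonal (fun A => ~ Q A) A.
    apply: right_orthogonal_sum p1i1 i1p1 _ => k.
    by rewrite mem_filter => /andP[/bQ /(right_orthogonalC_indecomposable (iT k))].
  have oB : right_orthogonal Q B.
    apply: right_orthogonal_sum p2i2 i2p2 _ => k; rewrite mem_filter.
    move=> /andP[/negP nb _]; apply: right_orthogonal_indecomposable => //.
    by move=> /bQ.
  (* Maps [A -> B] are killed by applying [right_orthogonal_hom0] to the complement of [Q], hence
     the double negation. *)
  have oA' : right_orthogonal (fun A => ~ ~ Q A) B.
    by move=> E u iE /NNPP; apply: oB.
  exists A, B; split=> //; exists i1, i2, p1, p2; split=> //.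
  + exact: right_orthogonal_hom0 oB oA.
  + exact: right_orthogonal_hom0 oA oA'.
  + by rewrite i1p1 i2p2 !big_filter -ip [RHS](bigID b).
- move=> A B S A' B' S' i1 i2 p1 p2 i1' i2' p1' p2' oA oB oA' oB'.
  move=> [p1i1 p2i2 p1i2 p2i1 ip] [p1i1' p2i2' p1i2' p2i1' ip'].
  have homBA (f : hom B A') : f = 0 by exact: right_orthogonal_hom0 oB oA'.
  have homAB (f : hom A B') : f = 0.
    apply: right_orthogonal_hom0 oA _ => //.
    by move=> E u iE /NNPP; apply: oB'.
  (* The inverse takes the diagonal entries of the matrix of [f]; the off-diagonal ones vanish by
     [homAB] and [homBA]. *)
  exists (fun f => (p1' ∘ f ∘ i1, p2' ∘ f ∘ i2)) => [[f g]|f] /=.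
    rewrite !compDr !compDl !compA p1i1' p2i2' p1i2' p2i1'.
    by rewrite -!compA p1i1 p2i2 p1i2 p2i1 !comp1m !compm1 !comp0m addr0 add0r.
  rewrite -[RHS]comp1m -ip' -[f in RHS]compm1 -ip !(compDl, compDr) !compA.
  rewrite -(compA i2' p2') -(compA i2' _ i1) (homAB (_ ∘ i1)).
  rewrite -(compA i1' p1') -(compA i1' _ i2) (homBA (_ ∘ i2)).
  by rewrite !compm0 !comp0m addr0 add0r.
Qed.

Lemma block_invariant X Y :
  is_block D -> indecomposable X -> indecomposable Y -> Q X -> Q Y.
Proof.
move=> [_ block] iX iY QX; apply: NNPP => nQY; apply: block.
exists (right_orthogonal (fun A => ~ Q A)), (right_orthogonal Q); split.
- exact: right_orthogonal_decomposition.
- by exists X; split; [apply: right_orthogonalC_indecomposable|case: iX].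
- by exists Y; split; [apply: right_orthogonal_indecomposable|case: iY].
Qed.

End Block.

(** * Extending paths and translating morphisms *)

Lemma path_rcons n X Y Z :
    is_path n X Y -> indecomposable Z ->
    (exists f : hom Y Z, f <> 0) \/ Z = shift Y ->
  is_path n.+1 X Z.
Proof.
move=> [P [P0 Pn iP stepP]] iZ stepZ.
exists (fun k => if (k <= n)%N then P k else Z).
split=> [//||k|k] /=; rewrite ?ltnn //; first by case: (leqP k n) => // /iP.
rewrite ltnS => kn; rewrite kn; case: ltnP => [/stepP//|nk].
by have -> : k = n by [apply/eqP; rewrite eqn_leq kn]; rewrite Pn.
Qed.

Lemma shiftn_neq0 n A B (f : hom A B) :
  f <> 0 -> exists g : hom (shiftn n A) (shiftn n B), g <> 0.
Proof.
move=> f0; elim: n => [|n [g g0]]; first by exists f.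
by exists (fmap shift g); apply: (fmap_neq0 equiv).
Qed.

Lemma indecomposable_shiftn n A : indecomposable A -> indecomposable (shiftn n A).
Proof. by move=> iA; elim: n => //= n /(indecomposable_fmap equiv _).1. Qed.

End Triangulated.

Theorem proposition4p9 (D : triangulated)
    (hsum : sums_of_indecomposables D) (hblock : is_block D)
    (X Y : D) (hX : indecomposable X) (hY : indecomposable Y) :
  exists (n m : nat), is_path m X (shiftn n Y).
Proof.
pose Q A := exists n m, is_path m X (shiftn n A).
have Qshift A : Q A <-> Q (shift A).
  (* Backwards this only reindexes, as [A[1][n] = A[n+1]]; forwards a translation step is appended
     to the path. *)
  split=> -[n [m path_A]]; last by exists n.+1, m; rewrite /shiftn iterSr.
  exists n, m.+1; rewrite /shiftn -iterSr /=.
  apply: (path_rcons path_A); last by right.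
  (* Indecomposability of [A[n]] is read off from the path, which ends there. *)
  have [P [_ Pm iP _]] := path_A.
  apply: (indecomposable_fmap (shift_equiv D) _).1.
  by rewrite -[iter _ _ _]Pm; apply: iP.
have Qforward A B (f : hom A B) : indecomposable B -> f <> 0 -> Q A -> Q B.
  move=> iB f0 [n [m path_A]]; exists n, m.+1; apply: (path_rcons path_A).
    exact: indecomposable_shiftn.
  by left; apply: shiftn_neq0 f0.
apply: (block_invariant hsum Qshift _ hblock hX hY); last first.
  by exists 0%N, 0%N, (fun=> X); split.
move=> A B f iA iB f0; split; first exact: (Qforward _ _ f).
move=> QB; have [[t t0]|[W [u [v [iW u0 v0]]]]] := hom_backward hsum iB f0.
  exact: (Qforward _ _ t).
have iFA := (indecomposable_fmap (shift_equiv D) A).1 iA.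
(* [Q] travels along [B -> W -> A[1]] and then back to [A] by translation invariance. *)
exact: (Qshift A).2 (Qforward _ _ v iFA v0 (Qforward _ _ u iW u0 QB)).
Qed.
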